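(* Let $\Lambda$ be a left hereditary ring. If the injective envelope of the left module ${}_{\Lambda}\Lambda$ is projective, then the stable category $\Lambda\text{-}\underline{\mathrm{Mod}}$ is conormal.
   Context: Rings are associative with identity; modules are left modules. The stable category $\Lambda\text{-}\underline{\mathrm{Mod}}$ has all left $\Lambda$-modules as objects; its morphisms are equivalence classes of $\Lambda$-homomorphisms, where $f$ and $g$ are equivalent if $f-g$ factors through a projective module. An epimorphism in a category is normal if it is a cokernel of some morphism; a category is conormal if every epimorphism in it is normal. *)

(* Defs.v *)
From HB Require Import structures.
From mathcomp Require Import all_boot all_algebra boolp.

Set Implicit Arguments.
Unset Strict Implicit.
Unset Printing Implicit Defensive.
Import GRing.Theory.
Local Open Scope ring_scope.
Local Open Scope quotient_scope.

Record category := Category {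
  ob :> Type;
  hom : ob -> ob -> Type;
  idm : forall A, hom A A;
  comp : forall A B C, hom B C -> hom A B -> hom A C;
  comp_idl : forall A B (f : hom A B), comp (idm B) f = f;
  comp_idr : forall A B (f : hom A B), comp f (idm A) = f;
  comp_assoc : forall A B C D (h : hom C D) (g : hom B C) (f : hom A B),
    comp h (comp g f) = comp (comp h g) f }.

Arguments hom {c} A B.
Arguments idm {c} A.
Arguments comp {c A B C} g f.

Section CategoricalNotions.
Variable K : category.

Definition epimorphism (B C : K) (e : hom B C) : Prop :=
  forall (D : K) (g h : hom C D), comp g e = comp h e -> g = h.

Definition zero_object (Z : K) : Prop :=
  forall A : K, (exists! f : hom A Z, True) /\ (exists! f : hom Z A, True).

Definition zero_morphism (A B : K) (f : hom A B) : Prop :=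
  exists (Z : K) (g : hom Z B) (h : hom A Z), zero_object Z /\ f = comp g h.

Definition is_cokernel (A B C : K) (f : hom A B) (e : hom B C) : Prop :=
  zero_morphism (comp e f) /\
  forall (D : K) (g : hom B D), zero_morphism (comp g f) ->
    exists! h : hom C D, comp h e = g.

Definition normal_epimorphism (B C : K) (e : hom B C) : Prop :=
  epimorphism e /\ exists (A : K) (f : hom A B), is_cokernel f e.

Definition conormal : Prop :=
  forall (B C : K) (e : hom B C), epimorphism e -> normal_epimorphism e.

End CategoricalNotions.

Section Modules.
Variable R : pzRingType.

Definition projective (P : lmodType R) : Prop :=
  forall (A B : lmodType R) (p : {linear A -> B}) (f : {linear P -> B}),
    (forall b, exists a, p a = b) ->
    exists g : {linear P -> A}, forall x, p (g x) = f x.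

Definition injective_module (E : lmodType R) : Prop :=
  forall (A B : lmodType R) (i : {linear A -> B}) (f : {linear A -> E}),
    injective i ->
    exists g : {linear B -> E}, forall x, g (i x) = f x.

(* Subsets are boolean predicates here; with the classical axioms of boolp
   every Prop-valued submodule is one of these. *)
Section Submodule.
Variables (V : lmodType R) (S : submodClosed V).
Definition submodule := {x : V | x \in S}.
HB.instance Definition _ := SubChoice.on submodule.
HB.instance Definition _ := [SubChoice_isSubLmodule of submodule by <:].
End Submodule.

(* The submodules of R^o, i.e. of R acting on itself by left multiplication,
   are the left ideals of R. *)
Definition left_hereditary : Prop :=
  forall I : submodClosed R^o, projective (submodule I).

(* The third clause says that i is essential. *)
Definition injective_envelope (M E : lmodType R) (i : {linear M -> E}) : Prop :=
  [/\ injective_module E, injective i &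
      forall S : submodClosed E, (exists x, x \in S /\ x <> 0) ->
        exists m, i m \in S /\ i m <> 0].

Definition factors_through_projective (M N : lmodType R)
    (f : {linear M -> N}) : Prop :=
  exists (P : lmodType R) (a : {linear M -> P}) (b : {linear P -> N}),
    projective P /\ forall x, f x = b (a x).

Lemma factors_ext (M N : lmodType R) (f g : {linear M -> N}) :
  f =1 g -> factors_through_projective f -> factors_through_projective g.
Proof.
by move=> fg [P [a [b [pP Pf]]]]; exists P, a, b; split=> // x; rewrite -fg.
Qed.

Lemma projective_prod (P Q : lmodType R) :
  projective P -> projective Q -> projective (P * Q)%type.
Proof.
move=> pP pQ A B p f p_surj.
pose inP x : P * Q := (x, 0); pose inQ y : P * Q := (0, y).
have inP_lin : linear inP.
  by move=> k x y; rewrite /inP; congr pair; rewrite /= scaler0 addr0.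
have inQ_lin : linear inQ.
  by move=> k x y; rewrite /inQ; congr pair; rewrite /= scaler0 addr0.
pose iP := GRing.isLinear.Build R P (P * Q)%type *:%R inP inP_lin.
pose iQ := GRing.isLinear.Build R Q (P * Q)%type *:%R inQ inQ_lin.
pose lP : {linear P -> (P * Q)%type} := HB.pack inP iP.
pose lQ : {linear Q -> (P * Q)%type} := HB.pack inQ iQ.
have [g Pg] := pP _ _ p (f \o lP) p_surj.
have [h Ph] := pQ _ _ p (f \o lQ) p_surj.
exists ((g \o fst) \+ (h \o snd)) => -[x y] /=.
rewrite linearD /= Pg Ph /= -linearD; congr (f _).
by rewrite /inP /inQ; congr pair; rewrite /= ?addr0 ?add0r.
Qed.

Lemma factors_add (M N : lmodType R) (f g : {linear M -> N}) :
  factors_through_projective f -> factors_through_projective g ->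
  factors_through_projective (f \+ g).
Proof.
move=> [P [a [b [pP Pf]]]] [Q [c [d [pQ Qg]]]].
pose ac x : P * Q := (a x, c x).
have ac_lin : linear ac by move=> k x y; rewrite /ac !linearP.
pose iac := GRing.isLinear.Build R M (P * Q)%type *:%R ac ac_lin.
pose lac : {linear M -> (P * Q)%type} := HB.pack ac iac.
exists (P * Q)%type, lac, ((b \o fst) \+ (d \o snd)).
by split; [exact: projective_prod | move=> x /=; rewrite Pf Qg].
Qed.

Lemma factors_comp (L M N O : lmodType R) (g : {linear N -> O})
    (f : {linear M -> N}) (h : {linear L -> M}) :
  factors_through_projective f -> factors_through_projective (g \o f \o h).
Proof.
move=> [P [a [b [pP Pf]]]]; exists P, (a \o h), (g \o b).
by split=> // x /=; rewrite Pf.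
Qed.

Definition linear_map (M N : lmodType R) : Type := {linear M -> N}.
HB.instance Definition _ M N := gen_eqMixin (linear_map M N).
HB.instance Definition _ M N := gen_choiceMixin (linear_map M N).

Definition stably_equal (M N : lmodType R) (f g : {linear M -> N}) : Prop :=
  factors_through_projective (f \- g).

Lemma stably_equal_refl (M N : lmodType R) (f : {linear M -> N}) :
  stably_equal f f.
Proof.
have p0 : projective 'rV[R]_0.
  move=> A B p g _; exists \0 => x.
  have -> : x = 0 by apply/rowP => -[].
  by rewrite !linear0.
by exists 'rV[R]_0, \0, \0; split=> // x /=; rewrite subrr.
Qed.

Lemma stably_equal_ext (M N : lmodType R) (f g : {linear M -> N}) :
  f =1 g -> stably_equal f g.
Proof.
by move=> fg; apply: factors_ext (stably_equal_refl f) => x /=; rewrite fg.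
Qed.

Lemma stably_equal_sym (M N : lmodType R) (f g : {linear M -> N}) :
  stably_equal f g -> stably_equal g f.
Proof.
move=> [P [a [b [pP Pfg]]]]; exists P, (\- a), b; split=> // x /=.
by rewrite linearN -Pfg /= opprB.
Qed.

Lemma stably_equal_trans (M N : lmodType R) (g f h : {linear M -> N}) :
  stably_equal f g -> stably_equal g h -> stably_equal f h.
Proof.
by move=> fg gh; apply: factors_ext (factors_add fg gh) => x /=; rewrite subrKA.
Qed.

Section StableHom.
Variables M N : lmodType R.

Definition stably_equalb : rel (linear_map M N) :=
  fun f g => `[< stably_equal f g >].

Lemma stably_equalb_refl : reflexive stably_equalb.
Proof. by move=> f; apply/asboolP/stably_equal_refl. Qed.

Lemma stably_equalb_sym : symmetric stably_equalb.
Proof. by move=> f g; apply/asboolP/asboolP; exact: stably_equal_sym. Qed.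

Lemma stably_equalb_trans : transitive stably_equalb.
Proof.
move=> g f h /asboolP fg /asboolP gh.
by apply/asboolP/(stably_equal_trans fg).
Qed.

Canonical stable_equiv := EquivRel stably_equalb
  stably_equalb_refl stably_equalb_sym stably_equalb_trans.

Definition stable_hom : Type := {eq_quot stable_equiv}.

End StableHom.

Definition stable_class (M N : lmodType R) (f : {linear M -> N}) :
    stable_hom M N :=
  \pi_{eq_quot stable_equiv M N} (f : linear_map M N).

Definition stable_repr (M N : lmodType R) (c : stable_hom M N) :
    {linear M -> N} :=
  repr (c : {eq_quot stable_equiv M N}).

Lemma stable_classP (M N : lmodType R) (f g : {linear M -> N}) :
  stable_class f = stable_class g <-> stably_equal f g.
Proof.
split=> [/eqmodP fg|fg]; first exact/asboolP.
by apply/eqmodP/asboolP.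
Qed.

Lemma stable_reprK (M N : lmodType R) (c : stable_hom M N) :
  stable_class (stable_repr c) = c.
Proof. exact: reprK. Qed.

Definition stable_id (M : lmodType R) : stable_hom M M :=
  stable_class (idfun : {linear M -> M}).

Definition stable_comp (L M N : lmodType R)
    (d : stable_hom M N) (c : stable_hom L M) : stable_hom L N :=
  stable_class (stable_repr d \o stable_repr c).

(* Composition does not depend on the representatives. *)
Lemma stable_comp_class (L M N : lmodType R)
    (g : {linear M -> N}) (f : {linear L -> M}) :
  stable_comp (stable_class g) (stable_class f) = stable_class (g \o f).
Proof.
apply/stable_classP; set g' := stable_repr _; set f' := stable_repr _.
have gg' : stably_equal g' g by apply/stable_classP/stable_reprK.
have ff' : stably_equal f' f by apply/stable_classP/stable_reprK.
have h1 := factors_comp idfun f' gg'; have h2 := factors_comp g idfun ff'.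
apply: factors_ext (factors_add h1 h2) => x /=.
by rewrite linearB subrKA.
Qed.

Lemma stable_comp_idl (M N : lmodType R) (c : stable_hom M N) :
  stable_comp (stable_id N) c = c.
Proof.
rewrite -[c]stable_reprK stable_comp_class; apply/stable_classP.
exact: stably_equal_ext.
Qed.

Lemma stable_comp_idr (M N : lmodType R) (c : stable_hom M N) :
  stable_comp c (stable_id M) = c.
Proof.
rewrite -[c]stable_reprK stable_comp_class; apply/stable_classP.
exact: stably_equal_ext.
Qed.

Lemma stable_comp_assoc (L M N O : lmodType R)
    (e : stable_hom N O) (d : stable_hom M N) (c : stable_hom L M) :
  stable_comp e (stable_comp d c) = stable_comp (stable_comp e d) c.
Proof.
rewrite -[e]stable_reprK -[d]stable_reprK -[c]stable_reprK !stable_comp_class.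
by apply/stable_classP/stably_equal_ext.
Qed.

Definition stable_category : category :=
  Category stable_comp_idl stable_comp_idr stable_comp_assoc.

End Modules.

(* Main.v *)
(* Every epimorphism e : B -> C becomes, after adding to B a projective mapping
   onto C, a surjection e1 in the stable category, with kernel K; one shows that
   e is the stable cokernel of K -> B. Let g : B -> D be such that g restricted
   to K factors as b \o a through a projective P. If P embeds in a projective
   injective Q, then a extends to beta : B -> Q, and beta induces
   q : C -> Q / a(K). Since q \o e1 factors through the projective Q and e is a
   stable epimorphism, q factors through a projective, hence lifts to a map
   r : C -> Q. Then beta - r \o e1 takes values in a(K), so it is an extension
   of a to a map s : B -> P, and g - b \o s vanishes on K.

   Every projective embeds in some direct sum of copies of E, so it remains to
   see that such a sum is injective. It suffices to extend maps from essential
   left ideals I. A maximal independent family X of elements of I spans an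
   essential left ideal, and no nonzero element of E is killed by an essential
   left ideal, so everything reduces to the finiteness of X, which is an argument
   of Osofsky: quotients of E are injective, and lifting a suitable endomorphism
   of such a quotient to E diagonalises against an infinite X. *)
Require Import Defs.
From HB Require Import structures.
From mathcomp Require Import all_boot all_algebra boolp.
From mathcomp Require Import classical_sets functions cardinality finmap.
Import GRing.Theory.
Local Open Scope ring_scope.
Set Implicit Arguments.
Unset Strict Implicit.
Unset Printing Implicit Defensive.

(** * Submodules, quotients and factorizations of linear maps *)

Lemma submodule_of (R : pzRingType) (V : lmodType R) (P : V -> Prop) :
  P 0 -> (forall x y, P x -> P y -> P (x + y)) ->
  (forall a x, P x -> P (a *: x)) ->
  exists S : submodClosed V, forall x, x \in S <-> P x.
Proof.
move=> P0 PD PZ.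
have closedP : subsemimod_closed (fun x => `[< P x >]).
  split; first split; first exact/asboolP.
  - by move=> x y /asboolP Px /asboolP Py; apply/asboolP/PD.
  - by move=> a x /asboolP Px; apply/asboolP/PZ.
pose cl := GRing.isSubmodClosed.Build R V (fun x => `[< P x >]) closedP.
pose S : submodClosed V := HB.pack (fun x => `[< P x >]) cl.
by exists S => x; split => /asboolP.
Qed.

Section LinearMaps.
Local Open Scope quotient_scope.
Variables (R : pzRingType).
Implicit Types (U V W : lmodType R).

Lemma linear_of U V (f : U -> V) :
  linear f -> exists g : {linear U -> V}, g =1 f.
Proof.
move=> f_lin; pose lf := GRing.isLinear.Build R U V *:%R f f_lin.
by exists (HB.pack_for {linear U -> V} f lf).
Qed.

Lemma quotient_module V (S : submodClosed V) :
  exists (Q : lmodType R) (p : {linear V -> Q}),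
    (forall q, exists v, p v = q) /\ (forall v, p v = 0 <-> v \in S).
Proof.
have zS : zmod_closed (fun v => v \in S).
  split=> [|x y xS yS]; first exact: rpred0.
  by rewrite -scaleN1r rpredD ?rpredZ.
pose Z : zmodClosed V :=
  HB.pack (fun v => v \in S) (GRing.isZmodClosed.Build V _ zS).
pose Q := {ideal_quot Z}.
pose pr (v : V) : Q := \pi_Q v.
have prP x y : pr x = pr y <-> x - y \in S.
  by rewrite -[_ \in S]/(_ \in Z) Quotient.idealrBE; split=> [/eqP|/eqP].
have prD : {morph pr : x y / x + y >-> x + y} by move=> x y; rewrite /pr !piE.
have pr0 : pr 0 = 0 by rewrite /pr !piE.
pose sc a (q : Q) : Q := pr (a *: repr q).
have scE a x : sc a (pr x) = pr (a *: x).
  apply/prP; rewrite -scalerBr; apply: rpredZ; apply/prP.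
  exact: reprK.
have sur q : exists v, pr v = q by exists (repr q); exact: reprK.
have scA a b v : sc a (sc b v) = sc (a * b) v.
  by have [x <-] := sur v; rewrite !scE scalerA.
have sc1 : left_id 1 sc by move=> v; have [x <-] := sur v; rewrite scE scale1r.
have scDr : right_distributive sc +%R.
  move=> a u v; have [x <-] := sur u; have [y <-] := sur v.
  by rewrite -prD !scE scalerDr prD.
have scDl v : {morph sc^~ v : a b / a + b}.
  by move=> a b; have [x <-] := sur v; rewrite !scE scalerDl prD.
pose QM := GRing.Zmodule_isLmodule.Build R Q scA sc1 scDr scDl.
pose QL : lmodType R := HB.pack Q QM.
have [p pE] : exists p : {linear V -> QL}, p =1 pr.
  apply: linear_of => a x y; rewrite prD; congr (_ + _); exact/esym/scE.
exists QL, p; split=> [q|v]; first by have [x <-] := sur q; exists x; rewrite pE.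
by rewrite pE -[0 : QL]pr0 -[v in v \in S]subr0; exact: prP.
Qed.

Lemma lift_mono U V W (j : {linear U -> V}) (f : {linear W -> V}) :
  injective j -> (forall w, exists u, j u = f w) ->
  exists g : {linear W -> U}, forall w, j (g w) = f w.
Proof.
move=> j_inj /choice[g jg].
have [|h hE] := @linear_of W U g; last by exists h => w; rewrite hE.
by move=> a x y; apply: j_inj; rewrite linearP !jg linearP.
Qed.

Lemma factor_epi U V W (e : {linear U -> V}) (f : {linear U -> W}) :
  (forall v, exists u, e u = v) -> (forall u, e u = 0 -> f u = 0) ->
  exists g : {linear V -> W}, forall u, g (e u) = f u.
Proof.
move=> /choice[s es] ker.
have kerE x y : e x = e y -> f x = f y.
  by move=> exy; apply/eqP; rewrite -subr_eq0 -linearB ker// linearB exy subrr.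
have [|g gE] := @linear_of V W (f \o s).
  by move=> a x y /=; rewrite -linearP; apply: kerE; rewrite linearP !es.
by exists g => u; rewrite gE; apply: kerE; rewrite es.
Qed.

Lemma image_module U V (f : {linear U -> V}) :
  exists S : submodClosed V, forall v, v \in S <-> exists u, f u = v.
Proof.
apply: submodule_of; first by exists 0; rewrite linear0.
- by move=> _ _ [x <-] [y <-]; exists (x + y); rewrite linearD.
- by move=> a _ [x <-]; exists (a *: x); rewrite linearZ.
Qed.

Lemma kernel_module U V (f : {linear U -> V}) :
  exists S : submodClosed U, forall u, u \in S <-> f u = 0.
Proof.
apply: submodule_of; first exact: linear0.
- by move=> x y fx fy; rewrite linearD fx fy addr0.
- by move=> a x fx; rewrite linearZ /= fx scaler0.
Qed.

(** By the kernel condition [u] descends to the image of [f]; a map on that submodule of [V] extends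
    to [V]. *)
Lemma injective_factor (E : lmodType R) U V (f : {linear U -> V})
    (u : {linear U -> E}) :
  injective_module E -> (forall x, f x = 0 -> u x = 0) ->
  exists g : {linear V -> E}, forall x, g (f x) = u x.
Proof.
move=> injE ker; have [S SP] := image_module f.
have vS : injective (val : submodule S -> V) by exact: val_inj.
have [|f' f'E] := @lift_mono (submodule S) V U val f vS.
  by move=> x; have fxS : f x \in S by [apply/SP; exists x]; exists (Sub (f x) fxS).
have [||v vE] := @factor_epi U (submodule S) E f' u.
- move=> y; have /SP[x xy] := valP y; exists x; apply: vS.
  by rewrite f'E.
- by move=> x f'x; apply: ker; rewrite -f'E f'x linear0.
have [g gE] := injE _ _ val v vS.
by exists g => x; rewrite -f'E gE vE.
Qed.

End LinearMaps.

(** * Direct sums of copies of a module *)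

Section DirectSum.
Local Open Scope classical_set_scope.
Variables (R : pzRingType) (X : choiceType) (M : lmodType R).

Definition finsupp : {pred X -> M} :=
  fun f => `[< finite_set [set x | f x <> 0] >].

Lemma finsupp_closed : subsemimod_closed finsupp.
Proof.
split; first split.
- apply/asboolP; rewrite (_ : [set _ | _] = set0)//.
  by apply/seteqP; split=> x //=; exact.
- move=> f g /asboolP f_fin /asboolP g_fin; apply/asboolP.
  have fg_fin : finite_set ([set x | f x <> 0] `|` [set x | g x <> 0]).
    by rewrite finite_setU.
  apply: sub_finite_set fg_fin => x /= fg0.
  have [fx0|] := pselect (f x = 0); last by left.
  by right => gx0; apply: fg0; rewrite -[LHS]/(f x + g x) fx0 gx0 addr0.
- move=> a f /asboolP f_fin; apply/asboolP; apply: sub_finite_set f_fin.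
  by move=> x /= afx fx; apply: afx; rewrite -[LHS]/(a *: f x) fx scaler0.
Qed.

HB.instance Definition _ :=
  GRing.isSubmodClosed.Build R (X -> M) finsupp finsupp_closed.

Definition dsum : lmodType R := submodule finsupp.

Definition dcoord (f : dsum) : X -> M := val f.

Lemma dcoordP a (f g : dsum) x :
  dcoord (a *: f + g) x = a *: dcoord f x + dcoord g x.
Proof. by []. Qed.

Definition supp (f : dsum) : seq X := fset_set [set x | dcoord f x <> 0].

Lemma suppP (f : dsum) x : reflect (dcoord f x <> 0) (x \in supp f).
Proof.
rewrite in_fset_set; last exact/asboolP/(valP f).
by apply: (iffP idP) => [/set_mem|fx]; last exact/mem_set.
Qed.

Lemma supp_uniq (f : dsum) : uniq (supp f).
Proof. exact: fset_uniq. Qed.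

Lemma dsum_eq (f g : dsum) : (forall x, dcoord f x = dcoord g x) -> f = g.
Proof. by move=> fg; apply/val_inj/funext. Qed.

Lemma dsum_of (f : X -> M) : finite_set [set x | f x <> 0] ->
  exists g : dsum, forall x, dcoord g x = f x.
Proof. by move=> f_fin; exists (Sub f (introT (asboolP _) f_fin)). Qed.

Lemma single_ex (x : X) : exists s : {linear M -> dsum},
  forall m y, dcoord (s m) y = if y == x then m else 0.
Proof.
have /choice[s sE] m : exists g : dsum, forall y, dcoord g y = if y == x then m else 0.
  apply: dsum_of; apply: sub_finite_set (finite_set1 x) => y /=.
  by case: eqP.
have [|t tE] := @linear_of R M dsum s; last by exists t => m y; rewrite tE.
move=> a m n; apply: dsum_eq => y; rewrite dcoordP !sE.
by case: eqP => //; rewrite scaler0 addr0.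
Qed.

Definition single (x : X) : {linear M -> dsum} := sval (cid (single_ex x)).

Lemma singleE x m y : dcoord (single x m) y = if y == x then m else 0.
Proof. by rewrite /single; case: cid => s /= ->. Qed.

Lemma dcoord0 x : dcoord 0 x = 0.
Proof. by []. Qed.

Lemma dcoord_sum I (r : seq I) (F : I -> dsum) x :
  dcoord (\sum_(i <- r) F i) x = \sum_(i <- r) dcoord (F i) x.
Proof. by elim/big_rec2: _ => // i m f _ <-. Qed.

Lemma dsumE (f : dsum) : f = \sum_(x <- supp f) single x (dcoord f x).
Proof.
apply: dsum_eq => y; rewrite dcoord_sum.
under eq_bigr do rewrite singleE.
have [ys|/suppP] := boolP (y \in supp f).
  rewrite (bigD1_seq y) ?supp_uniq//= eqxx big1 ?addr0// => x xy.
  by rewrite eq_sym (negbTE xy).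
move=> /contrapT fy0; rewrite fy0 big_seq big1// => x xs.
by case: eqP => [<-|//].
Qed.

Lemma eq_dsum_linear (N : lmodType R) (f g : {linear dsum -> N}) :
  (forall x m, f (single x m) = g (single x m)) -> f =1 g.
Proof.
move=> fg h; rewrite [h]dsumE !linear_sum.
by apply: eq_bigr => x _; exact: fg.
Qed.

Lemma dsum_lift (N : lmodType R) (g : X -> {linear M -> N}) :
  exists h : {linear dsum -> N},
    forall f, h f = \sum_(x <- supp f) g x (dcoord f x).
Proof.
(* Zero coordinates contribute nothing, so the sum may run over any larger duplicate-free list; one
   list then serves three supports at once. *)
have widen (s : seq X) (f : dsum) : uniq s -> {subset supp f <= s} ->
    \sum_(x <- supp f) g x (dcoord f x) = \sum_(x <- s) g x (dcoord f x).
  move=> s_uniq fs; rewrite [RHS](bigID (mem (supp f)))/= [X in _ + X]big1 ?addr0.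
    rewrite -[RHS]big_filter; apply: perm_big; apply: uniq_perm.
    - exact: supp_uniq.
    - exact: filter_uniq.
    - by move=> x; rewrite mem_filter; case: (boolP (x \in supp f)) => //= /fs ->.
  by move=> x /suppP/contrapT ->; rewrite linear0.
apply: linear_of => a f1 f2.
pose s := undup (supp f1 ++ supp f2 ++ supp (a *: f1 + f2)).
have us : uniq s by exact: undup_uniq.
rewrite (widen s f1)// ?(widen s f2)// ?(widen s (_ + _))//; first last.
- by move=> x; rewrite mem_undup !mem_cat => ->.
- by move=> x; rewrite mem_undup !mem_cat => ->; rewrite orbT.
- by move=> x; rewrite mem_undup !mem_cat => ->; rewrite !orbT.
rewrite scaler_sumr -big_split; apply: eq_bigr => x _ /=.
by rewrite dcoordP linearP.
Qed.

Lemma dsum_liftE (N : lmodType R) (g : X -> {linear M -> N}) :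
  exists h : {linear dsum -> N},
    (forall f, h f = \sum_(x <- supp f) g x (dcoord f x)) /\
    (forall x m, h (single x m) = g x m).
Proof.
have [h hE] := dsum_lift g; exists h; split=> // x m; rewrite hE.
have sub y : y \in supp (single x m) -> y = x.
  by move=> /suppP; rewrite singleE; case: eqP.
have [xs|/suppP/contrapT] := boolP (x \in supp (single x m)).
  rewrite (bigD1_seq x) ?supp_uniq//= big_seq_cond big1 ?addr0.
    by rewrite singleE eqxx.
  by move=> y /andP[/sub ->]; rewrite eqxx.
rewrite singleE eqxx => ->.
by rewrite [RHS]linear0 big1// => y _; rewrite linear0 dcoord0 linear0.
Qed.

Lemma dsum_proj (x : X) :
  exists p : {linear dsum -> M}, forall f, p f = dcoord f x.
Proof. exact: linear_of. Qed.

Lemma dsum_projective : projective M -> projective dsum.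
Proof.
move=> pM A B p f p_surj.
have /choice[g gE] x :
    exists g : {linear M -> A}, forall m, p (g m) = f (single x m).
  by have [g gE] := pM _ _ p (f \o single x) p_surj; exists g.
have [h [_ hE]] := dsum_liftE g; exists h => m.
rewrite -[LHS]/((p \o h) m); apply: eq_dsum_linear => x n /=.
by rewrite hE gE.
Qed.

End DirectSum.

Arguments single {R X M} x.
Arguments dsum R X M : clear implicits.

(** * Free modules and embeddings of projectives *)

Section Free.
Variable R : pzRingType.
Implicit Type V : lmodType R.

Lemma scale_map V (v : V) :
  exists g : {linear R^o -> V}, forall a : R, g a = a *: v.
Proof. by apply: linear_of => a b c; rewrite scalerDl scalerA. Qed.

Lemma comb_ex (X : choiceType) V (v : X -> V) :
  exists h : {linear dsum R X R^o -> V},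
    (forall f, h f = \sum_(x <- supp f) (dcoord f x : R) *: v x) /\
    (forall x (a : R), h (single x (a : R^o)) = a *: v x).
Proof.
have /choice[g gE] x := scale_map (v x).
have [h [hE hs]] := dsum_liftE g; exists h; split.
  by move=> f; rewrite hE; apply: eq_bigr => x _; exact: gE.
by move=> x a; rewrite hs gE.
Qed.

Lemma projective_free : projective (R^o : lmodType R).
Proof.
move=> A B p f p_surj; have [a pa] := p_surj (f 1).
have [g gE] := scale_map a; exists g => x.
by rewrite gE linearZ /= pa -linearZ; congr (f _); exact: mulr1.
Qed.

Lemma free_cover V : exists p : {linear dsum R V R^o -> V},
  forall v, exists f, p f = v.
Proof.
have [p [_ pE]] := comb_ex (idfun : V -> V).
by exists p => v; exists (single v (1 : R^o)); rewrite pE scale1r.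
Qed.

Lemma projective_embedding P : projective P ->
  exists j : {linear P -> dsum R P R^o}, injective j.
Proof.
move=> pP; have [p p_surj] := free_cover P.
by have [j jE] := pP _ _ p idfun p_surj; exists j; exact: can_inj jE.
Qed.

Lemma projective_embedding_in (E : lmodType R) (i : {linear R^o -> E}) P :
  injective i -> projective P ->
  exists j : {linear P -> dsum R P E}, injective j.
Proof.
move=> i_inj /projective_embedding[j j_inj].
have [h [_ hs]] := dsum_liftE (fun x : P => (single x : {linear E -> dsum R P E}) \o i).
have hE f x : dcoord (h f) x = i (dcoord f x).
  have [pE pEE] := dsum_proj E x; have [pR pRE] := dsum_proj (R^o) x.
  rewrite -pEE -pRE; move: f.
  apply: (eq_dsum_linear (f := pE \o h) (g := i \o pR)) => y m /=.
  by rewrite hs pEE pRE /= !singleE; case: ifP => //; rewrite linear0.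
exists (h \o j) => x y /= hxy; apply: j_inj; apply: dsum_eq => z.
by apply: i_inj; rewrite -!hE hxy.
Qed.

End Free.

(** * Baer's criterion and essential left ideals *)

Section Essential.
Local Open Scope classical_set_scope.
Variable R : pzRingType.

(** Every nonzero cyclic left ideal meets [I] outside 0. [I] is a bare set, so that a span given by
    an existential formula fits as well. *)
Definition essential (I : set R) : Prop :=
  forall r : R, r <> 0 -> exists c, I (c * r) /\ c * r <> 0.

Section Baer.
Variables (A B T : lmodType R) (i : {linear A -> B}) (f : {linear A -> T}).

(** Graphs of partial linear maps from [B] to [T] that agree with [f] along [i]; the last clause
    makes values unique. *)
Definition extension (G : set (B * T)) : Prop :=
  [/\ forall x, G (i x, f x), forall z w, G z -> G w -> G (z + w),
      forall a z, G z -> G (a *: z) & forall t, G (0, t) -> t = 0].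

(** Zorn's lemma on graphs: if [t] is compatible with all values already taken on multiples of [b],
    the multiples of [(b, t)] can be adjoined, so maximality puts them in [G]. *)
Lemma maximal_extension : injective i ->
  exists G, extension G /\
    forall b t, (forall a q, G (a *: b, q) -> q = a *: t) -> G (b, t).
Proof.
move=> i_inj.
pose G0 : set (B * T) := [set z | exists x, z = (i x, f x)].
have extG0 : extension G0.
  split.
  - by move=> x; exists x.
  - by move=> _ _ [x ->] [y ->]; exists (x + y); rewrite !linearD.
  - by move=> a _ [x ->]; exists (a *: x); rewrite !linearZ.
  - move=> t [x [ix0 ->]]; suff -> : x = 0 by rewrite linear0.
    by apply: i_inj; rewrite linear0.
(* The guard [G !=set0] admits the empty union of the empty chain. *)
have [|G [extG maxG]] := @Zorn_bigcup _ [set G | G !=set0 -> extension G].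
  move=> F Fext Ftot [z0 [X0 FX0 X0z0]].
  have ext X z : F X -> X z -> extension X by move=> FX Xz; apply: Fext => //; exists z.
  split.
  - by move=> x; exists X0 => //; have [+ _ _ _] := ext _ _ FX0 X0z0; apply.
  - move=> z w [X FX Xz] [Y FY Yw].
    have [XY|YX] := Ftot _ _ FX FY.
    + by exists Y => //; have [_ + _ _] := ext _ _ FY Yw; apply=> //; exact: XY.
    + by exists X => //; have [_ + _ _] := ext _ _ FX Xz; apply=> //; exact: YX.
  - move=> a z [X FX Xz]; exists X => //.
    by have [_ _ + _] := ext _ _ FX Xz; apply.
  - by move=> t [X FX Xt]; have [_ _ _ +] := ext _ _ FX Xt; apply.
have {}extG : extension G.
  apply: extG; apply/set0P/negP => /eqP G_empty.
  apply: (maxG G0) => [|_]; last exact: extG0.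
  by rewrite G_empty; split=> // /(_ (i 0, f 0)); apply; exists 0.
have [Gf GD GZ G0t] := extG.
exists G; split=> // b t bt.
pose G' : set (B * T) := [set z | exists w a, G w /\ z = w + a *: (b, t)].
have G00 : G 0 by have := Gf 0; rewrite !linear0.
have GG' : G `<=` G' by move=> z Gz; exists z, 0; rewrite scale0r addr0.
have extG' : extension G'.
  split.
  - by move=> x; apply: GG'.
  - move=> _ _ [z [a [Gz ->]]] [w [c [Gw ->]]]; exists (z + w), (a + c).
    by split; [exact: GD | rewrite scalerDl addrACA].
  - move=> c _ [z [a [Gz ->]]]; exists (c *: z), (c * a).
    by split; [exact: GZ | rewrite scalerDr scalerA].
  - move=> s [[x q] [a [Gxq []]]] /= xab ->.
    have /bt : G (- a *: b, q).
      by move: Gxq; rewrite scaleNr -[x](addrK (a *: b)) -xab sub0r.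
    by rewrite scaleNr => ->; rewrite addNr.
apply: contrapT => Gbt; apply: (maxG G') => //; split=> // G'G.
by apply/Gbt/G'G; exists 0, 1; rewrite scale1r add0r.
Qed.

End Baer.

(** The domain of a maximal partial extension meets every nonzero cyclic submodule, as otherwise a
    generator could be sent to 0. Hence the multipliers taking a given [b] into the domain form an
    essential left ideal. *)
Lemma essential_baer (T : lmodType R) :
  (forall (I : submodClosed R^o) (h : {linear submodule I -> T}),
    essential (fun r => (r : R^o) \in I) ->
    exists t, forall a, h a = (val a : R) *: t) ->
  injective_module T.
Proof.
move=> baerT A B i f i_inj.
have [G [[Gf GD GZ G0] maxG]] := maximal_extension f i_inj.
have G00 : G 0 by have := Gf 0; rewrite !linear0.
have Gfun x q q' : G (x, q) -> G (x, q') -> q = q'.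
  move=> Gq Gq'; apply/eqP; rewrite -subr_eq0; apply/eqP/G0.
  have := GD _ _ Gq (GZ (-1) _ Gq'); rewrite scaleN1r.
  by rewrite (_ : _ + _ = (x - x, q - q'))// subrr.
have ess x : x <> 0 -> exists a q, G (a *: x, q) /\ a *: x <> 0.
  move=> x0; apply: contrapT => nex.
  have /maxG Gx a q : G (a *: x, q) -> q = a *: 0.
    move=> Gq; have [ax0|ax0] := pselect (a *: x = 0).
      by move: Gq; rewrite ax0 scaler0 => /G0.
    by case: nex; exists a, q.
  by apply: nex; exists 1, 0; rewrite scale1r.
have total b : exists t, G (b, t).
  have [||| I IP] := @submodule_of R R^o (fun a : R => exists q, G (a *: b, q)).
  - by exists 0; rewrite scale0r.
  - move=> x y [q Gq] [q' Gq']; exists (q + q'); rewrite scalerDl.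
    exact: GD Gq Gq'.
  - move=> a x [q Gq]; exists (a *: q); rewrite -[a *: x]/(a * x) -scalerA.
    exact: GZ Gq.
  have /choice[h hE] (a : submodule I) : exists q, G ((val a : R) *: b, q).
    by have /IP := valP a.
  have [|h' h'E] := @linear_of R (submodule I) T h.
    move=> a x y; apply: Gfun (hE _) _.
    rewrite -[val _]/(a * (val x : R) + (val y : R)) scalerDl -scalerA.
    exact: GD (GZ _ _ (hE x)) (hE y).
  have [|t tE] := baerT I h'.
    move=> r r0; have [rb0|rb0] := pselect (r *: b = 0).
      by exists 1; rewrite mul1r; split=> //; apply/IP; exists 0; rewrite rb0.
    have [a [q [Gq arb0]]] := ess _ rb0; exists a; split.
      by apply/IP; exists q; rewrite -scalerA.
    by move=> ar0; apply: arb0; rewrite scalerA ar0 scale0r.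
  exists t; apply: maxG => a q Gq.
  have aI : (a : R^o) \in I by apply/IP; exists q.
  have := tE (Sub (a : R^o) aI); rewrite h'E SubK => <-.
  by apply: Gfun Gq _; exact: (hE (Sub (a : R^o) aI)).
have [g gE] := choice total.
have [|g' g'E] := @linear_of R B T g.
  move=> a x y; apply: Gfun (gE _) _.
  exact: GD (GZ a _ (gE x)) (gE y).
by exists g' => x; rewrite g'E; apply: Gfun (gE _) (Gf x).
Qed.

Lemma injective_ideal (E : lmodType R) (I : submodClosed R^o)
    (h : {linear submodule I -> E}) :
  injective_module E -> exists t, forall a, h a = (val a : R) *: t.
Proof.
move=> injE; have [g gE] := injE _ _ (val : submodule I -> R^o) h val_inj.
exists (g 1) => a; rewrite -gE -linearZ; congr (g _).
exact/esym/mulr1.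
Qed.

(** Ideals being projective, a map from an ideal to [Q] lifts to [E], where it is multiplication by
    an element. *)
Lemma hereditary_quotient (E Q : lmodType R) (p : {linear E -> Q}) :
  left_hereditary R -> injective_module E -> (forall q, exists e, p e = q) ->
  injective_module Q.
Proof.
move=> hered injE p_surj; apply: essential_baer => I h _.
have [g gE] := hered I _ _ p h p_surj.
have [t tE] := injective_ideal g injE.
by exists (p t) => a; rewrite -gE tE linearZ.
Qed.

(** [E] embeds in a free module, so coordinates reduce the claim to elements of [R]. *)
Lemma essential_faithful (E : lmodType R) (I : set R) (x : E) :
  left_hereditary R -> projective E -> essential I ->
  (forall a, I a -> a *: x = 0) -> x = 0.
Proof.
move=> hered pE essI Ix.
suff essR (r : R) : (forall a, I a -> a * r = 0) -> r = 0.
  have [j j_inj] := projective_embedding pE.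
  apply: j_inj; rewrite linear0; apply: dsum_eq => y; rewrite dcoord0.
  have [p pE'] := dsum_proj (R := R) R^o y.
  by apply: essR => a /Ix ax; rewrite -pE' -[_ * _]linearZ /= -linearZ ax !linear0.
(* As R r is projective, a |-> a * r splits: the annihilator of r, which
   contains I, is a direct summand, so it can be essential only if r = 0. *)
move=> Ir.
have [g gE] := @scale_map R R^o r.
have [S SP] := image_module g.
have [|u uE] := @lift_mono R (submodule S) R^o R^o val g val_inj.
  move=> a; have aS : g a \in S by [apply/SP; exists a].
  by exists (Sub (g a) aS).
have [|s sE] := hered S _ _ u idfun.
  move=> y; have /SP[a ay] := valP y; exists a; apply: val_inj.
  by rewrite uE.
pose t : R := s (u (1 : R^o)).
have st (a : R) : s (u a) = a * t.
  rewrite -[RHS]/(a *: (t : R^o)) -linearZ /= -linearZ; congr (s (u _)).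
  exact/esym/mulr1.
have tr : t * r = r.
  rewrite -[LHS]/(t *: (r : R^o)) -gE -uE sE uE gE; exact: mul1r.
apply: contrapT => r0.
have t0 : t <> 0 by move=> t0; apply: r0; rewrite -tr t0 mul0r.
(* Since [c * t] is in [I] it kills [r], so [c * r = c * t * r = 0]; then [u c = 0], and
   [c * t = s (u c)] vanishes. *)
have [c [Ict ct0]] := essI _ t0; apply: ct0.
rewrite -st; suff -> : u c = 0 by exact: linear0.
apply: val_inj; rewrite uE gE -[LHS]/(c * r) -tr mulrA Ir//.
Qed.

End Essential.

Section Osofsky.
Local Open Scope classical_set_scope.
Variable R : pzRingType.

(** Replacing vectors outside [X] by 0 lets combinations be indexed by all of [V], whatever [X]
    is. *)
Definition keep (V : nmodType) (X : set V) (v : V) : V :=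
  if `[< X v >] then v else 0.

Definition combination_ex (V : lmodType R) (X : set V) :=
  comb_ex (fun v => keep X v).

Definition combination (V : lmodType R) (X : set V) :
    {linear dsum R V R^o -> V} := sval (cid (combination_ex X)).

Lemma combinationE (V : lmodType R) (X : set V) f :
  combination X f = \sum_(x <- supp f) (dcoord f x : R) *: keep X x.
Proof. by rewrite /combination; case: cid => h []. Qed.

Lemma combination_single (V : lmodType R) (X : set V) x (a : R) :
  combination X (single x (a : R^o)) = a *: keep X x.
Proof. by rewrite /combination; case: cid => h []. Qed.

(* Independence of the cyclic submodules R x for x in X: the annihilators of the
   elements of X need not vanish. *)
Definition independent (V : lmodType R) (X : set V) : Prop :=
  forall f, combination X f = 0 -> forall x, (dcoord f x : R) *: keep X x = 0.

Lemma keepT (V : nmodType) (X : set V) v : X v -> keep X v = v.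
Proof. by move=> Xv; rewrite /keep asboolT. Qed.

Lemma keepF (V : nmodType) (X : set V) v : ~ X v -> keep X v = 0.
Proof. by move=> Xv; rewrite /keep asboolF. Qed.

Variables (E : lmodType R) (i : {linear R^o -> E}).
Hypotheses (hered : left_hereditary R) (i_inj : injective i).
Hypotheses (injE : injective_module E) (pE : projective E).

Section Independent.
Variable X : set R^o.
Hypotheses (indepX : independent X).
Hypothesis (X_neq0 : forall x, X x -> x <> 0).
Hypothesis (essX : essential (fun r => exists f, combination X f = (r : R^o))).

(** In a vanishing combination of an independent family each term vanishes, so keeping only the
    terms in [A] is well defined on the span of [X]; injectivity of [E] extends this map. *)
Lemma projection_ex (A : set R^o) : exists th : {linear E -> E},
  forall x, X x -> th (i x) = if `[< A x >] then i x else 0.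
Proof.
have [|th thE] := @injective_factor R E _ _ (i \o combination X)
  (i \o combination (X `&` A)) injE; last first.
  exists th => x Xx; have := thE (single x (1 : R^o)).
  rewrite /= !combination_single !scale1r keepT// => ->.
  case: asboolP => Ax; first by rewrite keepT.
  by rewrite keepF ?linear0// => -[].
move=> f /= if0; have /indepX f0 : combination X f = 0.
  by apply: i_inj; rewrite if0 linear0.
rewrite combinationE big1 ?linear0// => x _.
have [[Xx Ax]|XAx] := pselect ((X `&` A) x); last by rewrite keepF// scaler0.
by have := f0 x; rewrite !keepT.
Qed.

Definition projection (A : set R^o) : {linear E -> E} :=
  sval (cid (projection_ex A)).

Lemma projectionE A x :
  X x -> projection A (i x) = if `[< A x >] then i x else 0.
Proof. by move=> Xx; rewrite /projection; case: cid => th /= ->. Qed.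

(* For A and B with finite intersection the submodules generated by part A and
   part B are independent up to elements with finitely many nonzero
   coordinates. *)
Definition part (A : set R^o) : E := projection A (i 1).

Lemma i_scale (a : R) : i a = a *: i 1.
Proof. rewrite -linearZ; congr (i _); exact/esym/mulr1. Qed.

Lemma scale_part A (x : R^o) :
  X x -> (x : R) *: part A = if `[< A x >] then i x else 0.
Proof. by move=> Xx; rewrite -projectionE// [in RHS]i_scale linearZ. Qed.

(** The two sides agree after multiplication by any element of [X]. So the span of [X], which is
    essential, kills their difference. *)
Lemma projection_part A x : X x ->
  projection [set x] (part A) = if `[< A x >] then part [set x] else 0.
Proof.
move=> Xx; apply/eqP; rewrite -subr_eq0; apply/eqP.
apply: (essential_faithful hered pE essX) => _ [f <-].
have [h hE] := @scale_map R E (projection [set x] (part A) -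
  (if `[< A x >] then part [set x] else 0)).
rewrite -hE -[LHS]/((h \o combination X) f).
rewrite -[RHS]/((\0 : {linear _ -> E}) f).
apply: eq_dsum_linear => y a /=; rewrite combination_single hE.
have [Xy|Xy] := pselect (X y); last by rewrite keepF// scaler0 scale0r.
rewrite keepT// -scalerA scalerBr -linearZ /= scale_part//.
case: (asboolP (A x)) => Ax; case: (asboolP (A y)) => Ay;
  rewrite ?scale_part// ?scaler0 ?linear0 ?projectionE// ?subrr ?addr0 ?scaler0//.
- by rewrite asboolF ?subrr ?scaler0// => yx; apply: Ay; rewrite yx.
- by rewrite asboolF ?subrr ?scaler0// => yx; apply: Ax; rewrite -yx.
Qed.

Lemma small_closed : exists S : submodClosed E, forall y, y \in S <->
  finite_set [set x | X x /\ projection [set x] y <> 0].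
Proof.
apply: submodule_of.
- rewrite (_ : [set _ | _] = set0)//; apply/seteqP; split=> x //= [_].
  by rewrite linear0.
- move=> y z y_fin z_fin.
  apply: (@sub_finite_set _ _ ([set x | X x /\ projection [set x] y <> 0] `|`
    [set x | X x /\ projection [set x] z <> 0])); last by rewrite finite_setU.
  move=> x /= [Xx]; rewrite linearD.
  have [->|] := pselect (projection [set x] y = 0); last by left.
  by rewrite add0r; right.
- move=> a y; apply: sub_finite_set => x /= [Xx ay]; split=> // y0.
  by apply: ay; rewrite linearZ /= y0 scaler0.
Qed.

Section Blocks.
Variable g : nat * nat -> R^o.
Hypotheses (g_inj : injective g) (gX : forall n, X (g n)).

(** The blocks are the rows of an infinite array in [X]. The word meager has no topological meaning
    here. *)
Let block k : set R^o := [set g (k, j) | j in [set: nat]].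
Let meager : set (set R^o) := [set B | forall k, finite_set (B `&` block k)].

Lemma injective_range_infinite (h : nat -> R^o) :
  injective h -> infinite_set (range h).
Proof.
move=> h_inj fin; apply: infinite_nat.
apply: (@sub_finite_set _ _ (h @^-1` range h)) => [n _|]; first by exists n.
by apply: finite_preimage => // x y _ _; exact: h_inj.
Qed.

Lemma block_infinite k : infinite_set (block k).
Proof. by apply: injective_range_infinite => x y /g_inj[]. Qed.

(* Modulo the submodule S of elements with finitely many nonzero coordinates,
   map part A to itself when A is a block, and to 0 when A meets every block in a
   finite set. Extend to E -> E / S and lift to X' : E -> E. In each block, X'
   fixes the coordinate of some (in fact almost every) point; choosing one such
   point per block gives an infinite set B meeting every block in one point, and
   this contradicts X' (part B) \in S. *)
Lemma no_blocks : False.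
Proof.
have [S SP] := small_closed.
have [Q [p [p_surj p0]]] := quotient_module S.
have injQ := hereditary_quotient hered injE p_surj.
pose G : set (set R^o) := range block `|` meager.
have [al [alE al1]] :=
  comb_ex (fun A : set R^o => if `[< G A >] then part A else 0).
have [u [uE u1]] :=
  comb_ex (fun A : set R^o => if `[< range block A >] then p (part A) else 0).
have ker f : al f = 0 -> u f = 0.
  move=> alf; rewrite uE big_seq big1// => A0 A0f.
  case: asboolP => [[k _ A0k]|_]; last exact: scaler0.
  rewrite -linearZ /=; apply/p0/SP.
  (* [J] holds the other sets in the relation. Each meets [block k] in a finite set: distinct blocks
     are disjoint, and meager sets do so by definition. At a point of [A0] outside them only the
     [A0] term can have a nonzero coordinate, so this too is 0. *)
  pose J := [set` supp f] `&` (G `\ A0).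
  apply: (@sub_finite_set _ _ (\bigcup_(A in J) (A `&` block k))); last first.
    apply: bigcup_finite.
      by apply: sub_finite_set (finite_seq (supp f)) => A [].
    move=> A [_ [[[k' _ Ak']|mA] AA0]]; last exact: mA.
    rewrite (_ : _ `&` _ = set0)//; apply/seteqP; split=> // x [].
    rewrite -Ak' => -[j _ <-] [j' _ /g_inj[kk' _]]; apply: AA0.
    by rewrite -Ak' -A0k kk'.
  move=> x /= [Xx px]; apply: contrapT => xJ; apply: px.
  have [xA0|xA0] := pselect (A0 x); last first.
    by rewrite linearZ /= projection_part// asboolF// scaler0.
  rewrite -[RHS](linear0 (projection [set x])) -alf alE.
  rewrite (bigD1_seq A0) ?supp_uniq//= linearD asboolT; last by left; exists k.
  rewrite linear_sum big_seq_cond big1 ?addr0// => A /andP[Af AA0].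
  rewrite linearZ /=; case: asboolP => GA; last by rewrite linear0 scaler0.
  rewrite projection_part// asboolF ?scaler0// => Ax; apply: xJ.
  exists A; last by split=> //; rewrite A0k.
  by split=> //; split=> //; exact/eqP.
have [psi psiE] := injective_factor injQ ker.
have [X' X'E] := pE psi p_surj.
have X'part A : G A ->
    p (X' (part A)) = if `[< range block A >] then p (part A) else 0.
  move=> GA; have := psiE (single A (1 : R^o)).
  by rewrite al1 u1 !scale1r asboolT// X'E.
(* In a block with no such [j], every point would give a nonzero coordinate of
   [X' (part (block k)) - part (block k)], which lies in [S]. *)
have /choice[n nE] k : exists j, let x := g (k, j) in
    projection [set x] (X' (i x)) = i x.
  apply: contrapT => nex; apply: (block_infinite (k := k)).
  have /SP fin : X' (part (block k)) - part (block k) \in S.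
    apply/p0; rewrite linearB X'part; last by left; exists k.
    by rewrite asboolT ?subrr//; exists k.
  apply: sub_finite_set fin => x [j _ gx]; split; first by rewrite -gx.
  move=> px; apply: nex; exists j => /=; rewrite gx.
  have Xx : X x by rewrite -gx.
  have xpart : (x : R) *: part (block k) = i x.
    by rewrite scale_part// asboolT//; exists j.
  rewrite -xpart !linearZ /=; move: px; rewrite linearB => /subr0_eq ->.
  by rewrite -linearZ /= xpart projectionE// asboolT.
pose B := [set g (k, n k) | k in [set: nat]].
have B_infinite : infinite_set B.
  by apply: injective_range_infinite => x y /g_inj[].
have mB : meager B.
  move=> k; apply: sub_finite_set (finite_set1 (g (k, n k))).
  by move=> _ [[k' _ <-] [j _ /g_inj[-> _]]].
have /SP : X' (part B) \in S.
  apply/p0; rewrite X'part; last by right.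
  rewrite asboolF// => -[k _ Bk]; apply: (block_infinite (k := k)).
  by have := mB k; rewrite -Bk setIid.
apply: contra_not B_infinite; apply: sub_finite_set.
(* At a point [x] of [B] the coordinate of [X' (part B)] is nonzero: multiplied by [x] it becomes
   the coordinate of [X' (i x)], which is [i x]. *)
move=> _ [k _ <-]; split=> // px0; apply: (X_neq0 (gX (k, n k))).
apply: i_inj; rewrite linear0 -nE.
have <- : (g (k, n k) : R) *: part B = i (g (k, n k)).
  by rewrite scale_part// asboolT//; exists k.
by rewrite !linearZ /= px0 scaler0.
Qed.

End Blocks.

Lemma independent_finite : finite_set X.
Proof.
apply: contrapT => /infiniteP/card_leP[h].
pose g (n : nat * nat) : R^o :=
  set_val (h (SigSub (mem_set (I : [set: nat] (choice.pickle n))))).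
apply: (@no_blocks g) => [m n /val_inj mn|n]; last exact: set_valP.
have /(congr1 set_val) pmn := @inj _ _ _ h _ _ (mem_set I) (mem_set I) mn.
exact: (pcan_inj (@choice.pickleK _)) pmn.
Qed.

End Independent.
End Osofsky.

(** * Maximal independent families *)

Section Span.
Local Open Scope classical_set_scope.
Variables (R : pzRingType) (V : lmodType R).
Implicit Types (X : set V).

Lemma eq_keep X (Y : set V) (v : V) : (X v <-> Y v) -> keep X v = keep Y v.
Proof. by move=> /propext XY; rewrite /keep XY. Qed.

Lemma eq_combination X (Y : set V) (f : dsum R V R^o) :
  {in supp f, forall x, X x <-> Y x} -> combination X f = combination Y f.
Proof.
move=> XY; rewrite !combinationE big_seq [RHS]big_seq; apply: eq_bigr => x xf.
by rewrite (eq_keep (XY _ xf)).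
Qed.

Lemma combination_set1 y (f : dsum R V R^o) :
  combination [set y] f = (dcoord f y : R) *: y.
Proof.
have [p pE] := dsum_proj (R := R) (X := V) R^o y; have [g gE] := scale_map y.
rewrite -pE -gE; move: f; apply: (eq_dsum_linear (g := g \o p)) => x a /=.
rewrite combination_single gE pE singleE.
case: eqP => [->|yx]; first by rewrite keepT.
by rewrite keepF ?scaler0 ?scale0r// => xy; apply: yx.
Qed.

Lemma combinationU1 X y (f : dsum R V R^o) : ~ X y ->
  combination (X `|` [set y]) f = combination X f + combination [set y] f.
Proof.
move=> Xy; rewrite !combinationE -big_split; apply: eq_bigr => x _ /=.
rewrite -scalerDr; congr (_ *: _).
have [Xx|Xx] := pselect (X x).
  rewrite (keepT (X := X))// !(@keepT _ (_ `|` _))//; last by left.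
  by rewrite keepF ?addr0// => xy; apply: Xy; rewrite -xy.
rewrite (keepF (X := X))// add0r.
have [xy|xy] := pselect (x = y); first by rewrite !keepT//; right.
by rewrite !keepF// => -[].
Qed.

(** Zorn's lemma: a nonzero [y] in [I] whose multiples meet the span of [X] only in 0 could be
    adjoined to [X]. *)
Lemma maximal_independent (I : set V) : exists X,
  [/\ independent X, X `<=` I, forall x, X x -> x <> 0 &
    forall y, I y -> y <> 0 ->
      exists c f, combination X f = c *: y /\ c *: y <> 0].
Proof.
pose P := [set X | [/\ independent X, X `<=` I & forall x, X x -> x <> 0]].
have [F FP Ftot|X [[indepX XI X0] maxX]] := @Zorn_bigcup _ P.
  split; [|by move=> x [X FX Xx]; have [_ + _] := FP _ FX; apply
    |by move=> x [X FX Xx]; have [_ _ +] := FP _ FX; apply].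
  have [[X0 FX0]|F0] := pselect (F !=set0); last first.
    move=> f _ x; rewrite keepF ?scaler0// => -[X FX _].
    by apply: F0; exists X.
  (* A combination involves finitely many vectors, so one member of the chain contains all those
     that lie in the union. *)
  have bound (s : seq V) :
      exists2 X, F X & {in s, forall x, (\bigcup_(X in F) X) x -> X x}.
    elim: s => [|x s [X FX sX]]; first by exists X0.
    have [[Y FY Yx]|Fx] := pselect ((\bigcup_(X in F) X) x); last first.
      by exists X => // y; rewrite inE => /predU1P[->|/sX].
    have [XY|YX] := Ftot _ _ FX FY.
    - exists Y => // y; rewrite inE => /predU1P[->//|/sX sy /sy]; exact: XY.
    - exists X => // y; rewrite inE => /predU1P[-> _|/sX//]; exact: YX.
  move=> f; have [X FX fX] := bound (supp f).
  have XE : {in supp f, forall x, (\bigcup_(X in F) X) x <-> X x}.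
    by move=> x xf; split=> [|Xx]; [exact: fX | exists X].
  have [+ _ _] := FP _ FX; rewrite (eq_combination XE) => /[apply] f0 x.
  have [xf|/suppP/contrapT ->] := boolP (x \in supp f); last exact: scale0r.
  by have := f0 x; rewrite (eq_keep (XE _ xf)).
exists X; split=> // y Iy y0; apply: contrapT => nex.
have Xy : ~ X y.
  move=> Xy; apply: nex; exists 1, (single y (1 : R^o)).
  by rewrite combination_single keepT// !scale1r.
apply: (maxX (X `|` [set y])).
  by split=> [x|]; [left | move=> /(_ y)/= yX; apply: Xy; apply: yX; right].
split.
- move=> f; rewrite combinationU1// combination_set1 => f0.
  have fy : (dcoord f y : R) *: y = 0.
    apply: contrapT => fy; apply: nex; exists (dcoord f y), (- f); split=> //.
    by apply/eqP; rewrite linearN eq_sym -addr_eq0 addrC f0.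
  move: f0; rewrite fy addr0 => /indepX f0 x.
  have [xy|xy] := pselect (x = y); first by rewrite xy keepT//; right.
  have := f0 x; have [Xx|Xx] := pselect (X x).
    by rewrite !keepT//; left.
  by rewrite !keepF// => -[].
- by move=> x [/XI|->].
- by move=> x [/X0|->].
Qed.

End Span.

(** * Injectivity of direct sums of copies of [E] *)

Section DirectSumInjective.
Local Open Scope classical_set_scope.

(** Coordinatewise, [h] is multiplication by some [t y] in [E]. As the span of [X] is essential,
    [t y] is 0 once all of [X] kills it; since [X] is finite and each value of [h] has finite
    support, so has [t]. *)
Lemma dsum_injective (R : pzRingType) (E : lmodType R) (i : {linear R^o -> E})
    (Y : choiceType) :
  left_hereditary R -> injective i -> injective_module E -> projective E ->
  injective_module (dsum R Y E).
Proof.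
move=> hered i_inj injE pE; apply: essential_baer => I h essI.
have [X [indepX XI X0 maxX]] := maximal_independent [set x : R^o | x \in I].
have essX : essential (fun r : R => exists f, combination X f = (r : R^o)).
  move=> r r0; have [c [Icr cr0]] := essI r r0.
  have [d [f [fE dcr0]]] := maxX _ Icr cr0.
  by exists (d * c); rewrite -mulrA; split=> //; exists f.
have finX := independent_finite hered i_inj injE pE indepX X0 essX.
have /choice[t tE] y : exists t, forall a, dcoord (h a) y = (val a : R) *: t.
  have [p pE'] := dsum_proj E y.
  have [t tE] := injective_ideal (p \o h) injE.
  by exists t => a; rewrite -pE' -tE.
have [|T TE] := @dsum_of R Y E t.
  (* The default 0 is never taken for [x] in [X], as [X] lies in [I]. *)
  pose hx x := h (insubd 0 x).
  apply: (@sub_finite_set _ _ (\bigcup_(x in X) [set` supp (hx x)])); last first.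
    by apply: bigcup_finite => // x _; exact: finite_seq.
  move=> y /= ty; apply: contrapT => yX; apply: ty.
  apply: (essential_faithful hered pE essX) => _ [f <-].
  have [g gE] := scale_map (t y).
  rewrite -gE -[LHS]/((g \o combination X) f) -[RHS]/((\0 : {linear _ -> E}) f).
  apply: eq_dsum_linear => x a /=; rewrite combination_single linearZ /= gE.
  have [Xx|Xx] := pselect (X x); last by rewrite keepF// scale0r scaler0.
  rewrite keepT//; suff -> : x *: t y = 0 by exact: scaler0.
  have -> : x *: t y = dcoord (hx x) y by rewrite tE insubdK//; exact: XI.
  apply: contrapT => hxy; apply: yX; exists x => //; exact/suppP.
exists T => a; apply: dsum_eq => y.
by rewrite -[dcoord (_ *: T) y]/((val a : R) *: dcoord T y) TE tE.
Qed.

End DirectSumInjective.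

(** * Cokernels in the stable category *)

Section StableCategory.
Variable R : pzRingType.

Lemma stably_equal_to_projective (A P : lmodType R) (f g : {linear A -> P}) :
  projective P -> stably_equal f g.
Proof. by move=> pP; exists P, (f \- g), idfun. Qed.

Lemma stably_equal_from_projective (A P : lmodType R) (f g : {linear P -> A}) :
  projective P -> stably_equal f g.
Proof. by move=> pP; exists P, idfun, (f \- g). Qed.

Lemma stable_compE (L M N : lmodType R) (g : {linear M -> N})
    (f : {linear L -> M}) :
  @Defs.comp (stable_category R) _ _ _ (stable_class g) (stable_class f) =
  stable_class (g \o f).
Proof. exact: stable_comp_class. Qed.

Lemma factors_stably_equal0 (M N : lmodType R) (f : {linear M -> N}) :
  factors_through_projective f <-> stably_equal f \0.
Proof. by split; apply: factors_ext => x /=; rewrite subr0. Qed.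

Lemma projective_zero_object (P : lmodType R) :
  projective P -> zero_object (P : stable_category R).
Proof.
move=> pP A; split.
  exists (stable_class (\0 : {linear A -> P})); split=> // g _.
  by rewrite -[g]stable_reprK; apply/stable_classP/stably_equal_to_projective.
exists (stable_class (\0 : {linear P -> A})); split=> // g _.
by rewrite -[g]stable_reprK; apply/stable_classP/stably_equal_from_projective.
Qed.

(** The identity of a zero object is the class of 0, so every map through it is stably 0;
    conversely, projectives are zero objects. *)
Lemma zero_morphismP (M N : lmodType R) (f : {linear M -> N}) :
  zero_morphism (stable_class f : @Defs.hom (stable_category R) M N) <->
  factors_through_projective f.
Proof.
split=> [[Z [g [h [Z0 fgh]]]]|[P [a [b [pP fba]]]]].
  have [[z [_ zuniq]] _] := Z0 Z.
  have id0 : idm Z = stable_class (\0 : {linear Z -> Z}) :> stable_hom Z Z.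
    by rewrite -(zuniq (idm Z) I) -(zuniq (stable_class \0) I).
  apply/factors_stably_equal0/stable_classP; rewrite fgh -[h]comp_idl id0.
  rewrite -[g]stable_reprK -[h]stable_reprK !stable_compE.
  by apply/stable_classP/stably_equal_ext => x /=; rewrite linear0.
exists P, (stable_class b), (stable_class a); split.
  exact: projective_zero_object.
by rewrite stable_compE; apply/stable_classP/stably_equal_ext.
Qed.

Section Conormal.
Hypothesis enough : forall P : lmodType R, projective P ->
  exists (Q : lmodType R) (j : {linear P -> Q}),
    [/\ injective j, projective Q & injective_module Q].
Variables (B C : lmodType R) (e : {linear B -> C}).
Hypothesis epi_e :
  Defs.epimorphism (stable_class e : @Defs.hom (stable_category R) B C).

Lemma epi_zero (W : lmodType R) (q : {linear C -> W}) :
  factors_through_projective (q \o e) -> factors_through_projective q.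
Proof.
move=> /factors_stably_equal0/stable_classP qe.
apply/factors_stably_equal0/stable_classP/epi_e; rewrite !stable_compE qe.
exact/stable_classP/stably_equal_ext.
Qed.

Variables (F : lmodType R) (pi : {linear F -> C}).
Hypotheses (pF : projective F) (pi_surj : forall c, exists x, pi x = c).

Let e1 : {linear (B * F)%type -> C} := (e \o fst) \+ (pi \o snd).
Variable K : submodClosed (B * F)%type.
Hypothesis KP : forall z, z \in K <-> e1 z = 0.

Let e1_surj c : exists z, e1 z = c.
Proof.
by have [x <-] := pi_surj c; exists (0, x); rewrite /e1 /= linear0 add0r.
Qed.

(** The obstruction to making an extension of [a] land in [P] is the induced map [q] on [C], from
    which the stable epimorphism [e] can be cancelled. *)
Lemma retract_kernel (P : lmodType R) (a : {linear submodule K -> P}) :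
  projective P ->
  exists s : {linear (B * F)%type -> P}, forall k, s (val k) = a k.
Proof.
move=> pP; have [Q [j [j_inj pQ injQ]]] := enough pP.
have [beta betaE] := injQ _ _ (val : submodule K -> _) (j \o a) val_inj.
have [J JP] := image_module (j \o a).
have [W [w [w_surj w0]]] := quotient_module J.
have [|q qE] := @factor_epi R _ _ _ e1 (w \o beta) e1_surj.
  move=> z /KP zK; apply/w0/JP; exists (Sub z zK).
  by rewrite -betaE.
have [P2 [c [d [pP2 qdc]]]] : factors_through_projective q.
  apply: epi_zero.
  have zl : linear (fun b : B => (b, 0) : (B * F)%type).
    by move=> k x y; congr pair; rewrite /= scaler0 addr0.
  have [inl inlE] := linear_of zl.
  exists Q, (beta \o inl), w; split=> // b.
  by rewrite /= inlE -[RHS]/((w \o beta) _) -qE /e1 /= linear0 addr0.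
(* [d' \o c] lifts [q] to [Q]; subtracting [d' \o c \o e1] moves the values of [beta] into [J]
   without changing [beta] on [K]. *)
have [d' d'E] := pP2 _ _ w d w_surj.
have [|s sE] := @lift_mono R _ _ _ j (beta \- (d' \o c \o e1)) j_inj.
  move=> z; have /JP[k kE] : beta z - d' (c (e1 z)) \in J.
    apply/w0; rewrite linearB d'E -qdc qE /=; exact: subrr.
  by exists (a k); exact: kE.
exists s => k; apply: j_inj; rewrite sE -[LHS]/(beta (val k) - d' (c (e1 (val k)))).
by have /KP -> := valP k; rewrite !linear0 addr0 betaE.
Qed.

Lemma cokernel_of_kernel :
  is_cokernel
    (stable_class (fst \o val : {linear submodule K -> B})
      : @Defs.hom (stable_category R) (submodule K) B)
    (stable_class e).
Proof.
split.
  rewrite stable_compE; apply/zero_morphismP.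
  exists F, (\- (snd \o val)), pi; split=> // k /=.
  by have /KP/eqP := valP k; rewrite /e1 /= linearN addr_eq0 => /eqP.
move=> D g'; rewrite -[g']stable_reprK; set g := stable_repr g'.
rewrite stable_compE => /zero_morphismP[P [a [b [pP gba]]]].
have [s sE] := retract_kernel a pP.
have [|h hE] := @factor_epi R _ _ _ e1 ((g \o fst) \- (b \o s)) e1_surj.
  move=> z /KP zK; have := gba (Sub z zK).
  by rewrite /= -sE => ->; rewrite subrr.
(* On the summand [B] the equation for [h] reads [h \o e = g - b \o s \o inl], and the subtracted
   map factors through [P]. *)
have heg : @Defs.comp (stable_category R) _ _ _ (stable_class h) (stable_class e) =
    stable_class g.
  rewrite stable_compE; apply/stable_classP/stably_equal_sym.
  have zl : linear (fun b : B => (b, 0) : (B * F)%type).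
    by move=> k x y; congr pair; rewrite /= scaler0 addr0.
  have [inl inlE] := linear_of zl.
  exists P, (s \o inl), b; split=> // x /=.
  have := hE (x, 0); rewrite /e1 /= linear0 addr0 inlE => ->.
  by rewrite opprB addrC subrK.
exists (stable_class h); split=> // h' h'e; apply: epi_e.
by rewrite heg h'e.
Qed.

End Conormal.

Lemma conormal_stable_category :
  (forall P : lmodType R, projective P ->
    exists (Q : lmodType R) (j : {linear P -> Q}),
      [/\ injective j, projective Q & injective_module Q]) ->
  conormal (stable_category R).
Proof.
move=> enough B C e'; rewrite -[e']stable_reprK => epi_e; split=> //.
have [p p_surj] := free_cover (C : lmodType R).
have [K KP] := kernel_module ((stable_repr e' \o fst) \+ (p \o snd)).
eexists; eexists; apply: (cokernel_of_kernel enough epi_e _ p_surj KP).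
exact/dsum_projective/projective_free.
Qed.

End StableCategory.

Unset Implicit Arguments.

Theorem lemma8p10 (R : pzRingType) (E : lmodType R) (i : {linear R^o -> E}) :
  left_hereditary R -> injective_envelope i -> projective E ->
  conormal (stable_category R).
Proof.
move=> hered [injE i_inj _] pE; apply: conormal_stable_category => P pP.
have [j j_inj] := projective_embedding_in i_inj pP.
exists (dsum R P E), j; split=> //; first exact: dsum_projective.
exact: dsum_injective hered i_inj injE pE.
Qed.
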